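(* Let $G$ be an arbitrary group and let $A$ be a finite subset of $G$ which does not contain any (left or right) coset of any proper nontrivial finite subgroup of $G$. Then for any finite subset $B$ of $G$ with $|A| = |B|$ and $e \notin B$, there is a matching from $A$ to $B$.
   Context: $e$ denotes the neutral element of the group $G$ (written multiplicatively). For finite subsets $A, B$ of a group $G$, a matching from $A$ to $B$ is a bijection $f : A \to B$ such that $a f(a) \notin A$ for all $a \in A$. *)

(* Defs.v *)
From HB Require Import structures.
From mathcomp Require Import all_boot finmap.

Set Implicit Arguments.
Unset Strict Implicit.
Unset Printing Implicit Defensive.

Local Open Scope fset_scope.
Local Open Scope group_scope.

Definition proper_nontrivial_subgroup (G : groupType) (H : {fset G}) : Prop :=
  [/\ group_closed [pred x in H], H != [fset 1] & exists x : G, x \notin H].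

Definition left_coset (G : groupType) (x : G) (H : {fset G}) : {fset G} :=
  [fset x * h | h in H].

Definition right_coset (G : groupType) (H : {fset G}) (x : G) : {fset G} :=
  [fset h * x | h in H].

(* [f] is a map between the subtypes of [G] carried by [A] and [B]. *)
Definition matching (G : groupType) (A B : {fset G}) (f : A -> B) : Prop :=
  bijective f /\ forall a : A, val a * val (f a) \notin A.

(* Main.v *)
Require Import Defs.
From HB Require Import structures.
From mathcomp Require Import all_boot finmap zify.

(** If no matching exists, Hall's criterion fails for some S in A: writing T for
    the elements b of B with S b contained in A, one gets |S| + |T| > |A|, so
    Y = T u {1} satisfies S Y in A and |S| + |Y| > |A| + 1. Kemperman's transform
    (X, Y) -> (X u Xg, Y n g^-1 Y) or (X n Xg, Y u g^-1 Y) keeps the product set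
    inside A, and one of the two does not decrease |X| + |Y|. A pair X, Y maximal
    for (|X| + |Y|, |X|) therefore shows that A contains a left coset of a
    nontrivial finite subgroup, which is proper because A is not all of G. *)

(** Rado's argument, by induction on the total size of the sets [N t]. If all are singletons, Hall's
    condition makes them distinct. Otherwise some [N t] has two elements, and deleting a suitable
    one of them preserves Hall's condition. *)
Lemma hall_marriage (T U : finType) (N : T -> {set U}) :
  (forall S : {set T}, #|S| <= #|\bigcup_(t in S) N t|) ->
  exists2 f : T -> U, injective f & forall t, f t \in N t.
Proof.
have [n le_n] := ubnP (\sum_t #|N t|).
elim: n => // n IHn in N le_n * => hallN.
case: (pickP (fun t => 1 < #|N t|)) => [t N_t | N_le1]; last first.
  have /fin_all_exists[f Nf] (t : T) : exists u, N t = [set u].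
    apply/cards1P; rewrite eqn_leq leqNgt N_le1 /=.
    by have := hallN [set t]; rewrite cards1 big_set1.
  exists f => [t1 t2 eq_f | t]; last by rewrite Nf set11.
  apply/eqP; apply: contraT => neq12.
  have := hallN [set t1; t2].
  by rewrite bigcup_setU !big_set1 !Nf eq_f setUid cards1 cards2 neq12.
pose N' u s := if s == t then N t :\ u else N s.
have sub_N' u s : N' u s \subset N s.
  by rewrite /N'; case: eqP => // ->; apply: subD1set.
have [[u Nu hallN']|noN'] : (exists2 u, u \in N t &
      forall S : {set T}, #|S| <= #|\bigcup_(s in S) N' u s|) \/
    {in N t, forall u, exists S : {set T},
       #|\bigcup_(s in S) N' u s| < #|S|}.
- case: (pickP [pred u | (u \in N t) && [forall S : {set T},
          #|S| <= #|\bigcup_(s in S) N' u s|]]) => [u /andP[Nu /forallP]|noN'].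
    by left; exists u.
  right=> u Nu; have:= noN' u; rewrite /= Nu /= => /negbT.
  by case/forallPn=> S; rewrite -ltnNge; exists S.
- have [|f f_inj Nf] := IHn (N' u) _ hallN'.
    rewrite -ltnS; apply: leq_trans le_n.
    rewrite ltnS (bigD1 t) //= [X in _ < X](bigD1 t) //=.
    rewrite -addSn leq_add ?leq_sum //; last first.
      by move=> s _; rewrite subset_leq_card.
    by rewrite /N' eqxx (cardsD1 u (N t)) Nu.
  by exists f => // s; apply: (subsetP (sub_N' u s)).
have /card_gt1P[u1 [u2 [Nu1 Nu2 neq_u]]] := N_t.
have [S1 ltS1] := noN' u1 Nu1; have [S2 ltS2] := noN' u2 Nu2.
(* Deleting [u] changes only [N t], so a set avoiding [t] still satisfies Hall's condition. *)
have violating_t u (S : {set T}) : #|\bigcup_(s in S) N' u s| < #|S| -> t \in S.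
  apply: contraLR => Sn't; rewrite -leqNgt (leq_trans (hallN S)) //.
  rewrite subset_leq_card //; apply/bigcupsP => s Ss.
  apply: (bigcup_max s) => //; rewrite /N'; case: eqP => // eq_st.
  by rewrite -eq_st Ss in Sn't.
have tS1 := violating_t _ _ ltS1; have tS2 := violating_t _ _ ltS2.
set P1 := \bigcup_(s in S1) _ in ltS1; set P2 := \bigcup_(s in S2) _ in ltS2.
(* The violating sets [S1] and [S2] contradict the submodularity of [|N(S)|]. *)
have leU : #|S1 :|: S2| <= #|P1 :|: P2|.
  apply: leq_trans (hallN _) _; apply: subset_leq_card.
  apply/subsetP=> u /bigcupP[s Ss Nsu].
  (* No neighbour of [t] is lost: [P1] misses at most [u1], which [P2] retains since [u1 != u2]. *)
  have [eq_st|neq_st] := eqVneq s t.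
    rewrite inE; apply/orP; have [eq_u|neq_u1] := eqVneq u u1; last first.
      by left; apply/bigcupP; exists t; rewrite // /N' eqxx !inE neq_u1 -eq_st.
    by right; apply/bigcupP; exists t; rewrite // /N' eqxx !inE eq_u neq_u.
  rewrite inE; apply/orP; case/setUP: Ss => Ss; [left | right];
    by apply/bigcupP; exists s; rewrite // /N' (negPf neq_st).
(* The 1 accounts for [t], the only point where [N'] may be smaller than [N]. The two violations
   together leave a gap of 2, which this 1 cannot fill. *)
have leI : #|S1 :&: S2| <= #|P1 :&: P2|.+1.
  rewrite (cardsD1 t) inE tS1 tS2 add1n ltnS.
  apply: leq_trans (hallN _) _; apply: subset_leq_card.
  apply/bigcupsP=> s; rewrite !inE => /and3P[neq_st S1s S2s].
  rewrite subsetI; apply/andP.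
  by split; apply: (bigcup_max s); rewrite // /N' (negPf neq_st).
have := leq_add leU leI.
rewrite addnS !cardsUI => /leq_trans/(_ (_ : _ <= #|P1|.+1 + #|P2|)).
rewrite addSn leqnn => /(_ isT).
by rewrite leqNgt (leq_trans _ (leq_add ltS1 ltS2)) // addSn addnS.
Qed.

(** The lexicographic order on (x + y, x) is coded in base a + 1, where x <= a is a digit. The old
    code is below (2a + 1)(a + 1), so the truncated subtraction is positive and strictly drops. *)
Lemma lexicographic_step (n a x y x' y' : nat) :
  x <= a -> y <= a -> x + y <= x' + y' -> x + y < x' + y' \/ x < x' ->
  a.*2.+1 * a.+1 - ((x + y) * a.+1 + x) < n.+1 ->
  a.*2.+1 * a.+1 - ((x' + y') * a.+1 + x') < n.
Proof. nia. Qed.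

Local Open Scope fset_scope.
Local Open Scope group_scope.

Lemma mem_mulr_fset (G : groupType) (X : {fset G}) (g z : G) :
  (z \in [fset x * g | x in X]) = (z * g^-1 \in X).
Proof.
apply/imfsetP/idP => [[x /= Xx ->]|Xz]; first by rewrite mulgK.
by exists (z * g^-1); rewrite //= mulgVK.
Qed.

Lemma mem_mull_fset (G : groupType) (Y : {fset G}) (g z : G) :
  (z \in [fset g * y | y in Y]) = (g^-1 * z \in Y).
Proof.
apply/imfsetP/idP => [[y /= Yy ->]|Yz]; first by rewrite mulKg.
by exists (g^-1 * z); rewrite //= mulVKg.
Qed.

Lemma card_mulr_fset (G : groupType) (X : {fset G}) (g : G) :
  #|` [fset x * g | x in X]| = #|` X|.
Proof. by rewrite card_imfset //; apply: mulIg. Qed.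

Lemma card_mull_fset (G : groupType) (Y : {fset G}) (g : G) :
  #|` [fset g * y | y in Y]| = #|` Y|.
Proof. by rewrite card_imfset //; apply: mulgI. Qed.

(* For a pair [X], [Y] that no Kemperman transform improves, [X^-1 X] and [Y Y^-1]
   meet in a common stabiliser [D], and [x D y = (x y) (y^-1 D y)] is a left coset
   inside [A]; if [D] were trivial, all products [x y] would be distinct. *)
Lemma left_coset_of_small_product (G : groupType) (A X Y : {fset G}) :
  X != fset0 -> Y != fset0 ->
  (forall x y, x \in X -> y \in Y -> x * y \in A) ->
  (#|` A|.+1 < #|` X| + #|` Y|)%N ->
  exists H : {fset G}, exists2 x : G,
    group_closed [pred h in H] /\ H != [fset 1] & left_coset x H `<=` A.
Proof.
set a := #|` A|.
have [n] := ubnP (a.*2.+1 * a.+1 - ((#|` X| + #|` Y|) * a.+1 + #|` X|))%N.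
elim: n => // n IHn in X Y * => le_n X0 Y0 XYA ltA.
have [/fset0Pn[x0 Xx0] /fset0Pn[y0 Yy0]] := (X0, Y0).
have leX : (#|` X| <= a)%N.
  rewrite -(card_mulr_fset _ X y0); apply: fsubset_leq_card.
  by apply/fsubsetP=> _ /imfsetP[x /= Xx ->]; apply: XYA.
have leY : (#|` Y| <= a)%N.
  rewrite -(card_mull_fset _ Y x0); apply: fsubset_leq_card.
  by apply/fsubsetP=> _ /imfsetP[y /= Yy ->]; apply: XYA.
pose D := [fset g in [fset x^-1 * x' | x in X, x' in X]
          | g \in [fset y * y'^-1 | y in Y, y' in Y]].
have memD x x' y y' g : x \in X -> x' \in X -> y \in Y -> y' \in Y ->
    g = x^-1 * x' -> g = y * y'^-1 -> g \in D.
  move=> Xx Xx' Yy Yy' gX gY; rewrite !inE /=; apply/andP; split.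
    by apply/imfset2P; exists x => //; exists x'.
  by apply/imfset2P; exists y => //; exists y'.
pose stab g := ([fset x * g | x in X] == X) && ([fset g^-1 * y | y in Y] == Y).
have [/existsP[[g /= Dg] Ng] | stabD] := boolP [exists g : D, ~~ stab (val g)].
  have /andP[/imfset2P[x /= Xx [x' /= Xx' gX]]
             /imfset2P[y /= Yy [y' /= Yy' gY]]] :
    (g \in [fset x^-1 * x' | x in X, x' in X])
    && (g \in [fset y * y'^-1 | y in Y, y' in Y]) by move: Dg; rewrite !inE.
  set Xg := [fset x * g | x in X] in Ng.
  set gY' := [fset g^-1 * y | y in Y] in Ng.
  have cardX := cardfsUI X Xg; have cardY := cardfsUI Y gY'.
  rewrite card_mulr_fset in cardX; rewrite card_mull_fset in cardY.
  have intersect1 : [/\ X `|` Xg != fset0, Y `&` gY' != fset0 &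
      forall u v, u \in X `|` Xg -> v \in Y `&` gY' -> u * v \in A].
    split; first by apply/fset0Pn; exists x; rewrite inE Xx.
      apply/fset0Pn; exists y'; rewrite inE Yy' mem_mull_fset invgK gY.
      by rewrite mulgVK.
    move=> u v; rewrite !inE mem_mulr_fset mem_mull_fset invgK.
    case/orP=> [Xu|Xu] /andP[Yv Ygv]; first exact: XYA.
    by rewrite -(mulgVK g u) -mulgA XYA.
  have intersect2 : [/\ X `&` Xg != fset0, Y `|` gY' != fset0 &
      forall u v, u \in X `&` Xg -> v \in Y `|` gY' -> u * v \in A].
    split; last 1 first.
    - move=> u v; rewrite !inE mem_mulr_fset mem_mull_fset invgK.
      case/andP=> [Xu Xgu] /orP[Yv|Yv]; first exact: XYA.
      by rewrite -(mulgVK g u) -mulgA XYA.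
    - apply/fset0Pn; exists x'; rewrite inE Xx' mem_mulr_fset gX.
      by rewrite invgM invgK mulVKg.
    - by apply/fset0Pn; exists y; rewrite inE Yy.
  (* By [cardX] and [cardY] the sums for the two transforms add up to 2(|X| + |Y|): if the first one
     decreases, the second one grows. *)
  have [leU|ltU] := leqP (#|` X| + #|` Y|) (#|` X `|` Xg| + #|` Y `&` gY'|).
    case: intersect1 => X1 Y1 XYA1; apply: (IHn _ _ _ X1 Y1 XYA1); last first.
      exact: leq_trans leU.
    have gain : (#|` X| + #|` Y| < #|` X `|` Xg| + #|` Y `&` gY'|)%N
                \/ (#|` X| < #|` X `|` Xg|)%N.
      have [ltX|geX] := ltnP #|` X| #|` X `|` Xg|; [by right | left].
      (* If X u Xg is no larger than X, then g stabilises X, so it must move Y. Then Y n g^-1 Y is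
         strictly smaller than Y, against [leU]. *)
      have XgX : Xg == X.
        rewrite eqEfcard card_mulr_fset leqnn andbT; apply/fsetUidPl/esym/eqP.
        by rewrite eqEfcard fsubsetUl.
      move: Ng; rewrite /stab -/Xg -/gY' XgX /= => gY'Y.
      suff : (#|` Y `&` gY'| < #|` Y|)%N by move: leU geX; clear; lia.
      apply: fproper_ltn_card; rewrite fproperEneq fsubsetIl andbT.
      apply: contraNneq gY'Y => YI.
      by rewrite eq_sym eqEfcard card_mull_fset leqnn andbT -{1}YI fsubsetIr.
    exact: lexicographic_step leX leY leU gain le_n.
  case: intersect2 => X2 Y2 XYA2; apply: (IHn _ _ _ X2 Y2 XYA2).
    apply: lexicographic_step leX leY _ _ le_n; last left;
      by move: ltU cardX cardY; clear; lia.
  move: ltU ltA cardX cardY; clear; lia.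
have {}stabD g : g \in D -> stab g.
  by move=> Dg; apply: contraNT stabD => Ng; apply/existsP; exists [` Dg].
have stabX g x : g \in D -> x \in X -> x * g \in X.
  by move=> /stabD/andP[/eqP eqX _] Xx; rewrite -eqX mem_mulr_fset mulgK.
have stabY g y : g \in D -> y \in Y -> g * y \in Y.
  by move=> /stabD/andP[_ /eqP eqY]; rewrite -{1}eqY mem_mull_fset invgK.
pose H := [fset y0^-1 * g * y0 | g in D].
exists H, (x0 * y0).
  split; last first.
    apply: contraTneq ltA => H1; rewrite -leqNgt.
    have D1 g : g \in D -> g = 1.
      move=> Dg; have : y0^-1 * g * y0 \in H by apply/imfsetP; exists g.
      by rewrite H1 inE -mulgA -conjgE conjg_eq1 => /eqP.
    (* For positive sizes, (|X| - 1)(|Y| - 1) >= 0 gives |X| + |Y| <= |X||Y| + 1. *)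
    suff : (#|` X| * #|` Y| <= a)%N.
      have : (0 < #|` X| /\ 0 < #|` Y|)%N by rewrite !cardfs_gt0.
      nia.
    pose mulXY (p : X * Y) : A := [` XYA _ _ (valP p.1) (valP p.2)].
    have /leq_card : injective mulXY.
      move=> [[x Xx] [y Yy]] [[x' Xx'] [y' Yy']] /(congr1 val) /= eqxy.
      have eqg : x^-1 * x' = y * y'^-1.
        by apply: (mulgI x); rewrite mulVKg mulgA eqxy mulgK.
      have eq1 := D1 _ (memD x x' y y' _ Xx Xx' Yy Yy' erefl eqg).
      have eqy : y = y' by apply: divg1_eq; rewrite -eqg.
      move: eqxy Xx Yy; rewrite eqy => /mulIg-> Xx Yy.
      by congr pair; apply: val_inj.
    by rewrite card_prod -!cardfE.
  have D1 : 1 \in D by apply: (memD x0 x0 y0 y0); rewrite ?mulVg ?mulgV.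
  (* As g and k stabilise both sets, g / k sends [x0] into X and [y0] into Y, which exhibits it in
     X^-1 X and in Y Y^-1. *)
  have DV g k : g \in D -> k \in D -> g / k \in D.
    move=> Dg Dk; have /andP[/eqP eqX /eqP eqY] := stabD k Dk.
    apply: (memD x0 (x0 * (g / k)) (g / k * y0) y0); rewrite ?mulKg ?mulgK //.
      by rewrite mulgA -mem_mulr_fset eqX stabX.
    by rewrite -mulgA stabY // -eqY mem_mull_fset invgK mulVKg.
  split.
    by rewrite inE; apply/imfsetP; exists 1; rewrite // mulg1 mulVg.
  move=> _ _ /imfsetP[g /= Dg ->] /imfsetP[k /= Dk ->].
  apply/imfsetP; exists (g / k); first exact: DV.
  by rewrite !invgM !invgK !mulgA mulgK.
apply/fsubsetP=> _ /imfsetP[_ /= /imfsetP[g /= Dg ->] ->].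
by rewrite !mulgA mulgK -mulgA XYA // stabY.
Qed.

Theorem theorem1p2 (G : groupType) (A : {fset G})
  (hA : forall (H : {fset G}) (x : G), proper_nontrivial_subgroup H ->
     ~~ (left_coset x H `<=` A) /\ ~~ (right_coset H x `<=` A))
  (B : {fset G}) (hAB : #|` A| = #|` B|) (hB : 1 \notin B) :
  exists f : A -> B, matching f.
Proof.
pose N (a : A) := [set b : B | val a * val b \notin A].
have [|f f_inj Nf] := @hall_marriage A B N; last first.
  exists f; split=> [|a]; last by have := Nf a; rewrite inE.
  by apply: inj_card_bij f_inj _; rewrite -!cardfE hAB.
move=> S; rewrite leqNgt; apply/negP => ltS.
set NS := (\bigcup_(a in S) N a)%SET in ltS.
pose X := [fset val a | a in S]; pose Y := 1 |` [fset val b | b in (~: NS)%SET].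
have cardX : #|` X| = #|S|.
  by rewrite card_imfset ?cardE //; apply: val_inj.
(* Here [hB] makes 1 a genuinely new element; this extra unit yields the strict bound |A| + 1 < |X|
   + |Y|. *)
have cardY : #|` Y| = #|(~: NS)%SET|.+1.
  rewrite cardfsU1 card_imfset ?cardE /=; last exact: val_inj.
  case: imfsetP => // -[b _ /= eq1]; move: hB; rewrite eq1.
  by rewrite (valP b).
have cardNS : (#|NS| + #|(~: NS)%SET| = #|` A|)%N by rewrite cardsC hAB cardfE.
have [||||H [x [grpH ntH] HA]] := @left_coset_of_small_product G A X Y.
- by rewrite -cardfs_gt0 cardX (leq_trans _ ltS).
- by rewrite -cardfs_gt0 cardY.
- move=> _ y /imfsetP[a /= Sa ->]; rewrite !inE => /orP[/eqP->|].
    by rewrite mulg1 (valP a).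
  case/imfsetP=> b /= NSb ->; apply: contraTT NSb => Nab.
  by rewrite inE negbK; apply/bigcupP; exists a; rewrite ?inE.
- by rewrite cardX cardY -cardNS addnS ltnS -addSn leq_add2r.
(* If B lies in A, equal cardinality gives B = A, and then 1 is outside A. A point y outside A gives
   x^-1 y outside H, since xH lies in A. *)
have [y Ay] : exists y, y \notin A.
  have [B_A|/fsubsetPn[y _ Ay]] := boolP (B `<=` A); last by exists y.
  by exists 1; have /eqP<- : B == A by rewrite eqEfcard B_A hAB leqnn.
have [|/negP[]//] := hA H x.
split=> //; exists (x^-1 * y); apply: contra Ay => Hy.
apply: (fsubsetP HA); apply/imfsetP; exists (x^-1 * y) => //.
by rewrite mulVKg.
Qed.
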